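(* Let $X$ be a regular Lindelöf topological space. Then $t(X_\delta) \le 2^{t(X)}$, where $X_\delta$ is the $G_\delta$-modification of $X$ and $t$ denotes tightness.
   Context: The $G_\delta$-modification $X_\delta$ of a topological space $X$ is the space on the same underlying set whose topology has as a basis the collection of all $G_\delta$ subsets of $X$ (countable intersections of open subsets of $X$). For a point $p$ of a space $X$, the tightness $t(p,X)$ is the smallest infinite cardinal $\kappa$ such that whenever $A \subseteq X$ and $p \in \overline{A}$, there is $B \subseteq A$ with $|B| \le \kappa$ and $p \in \overline{B}$; the tightness of $X$ is $t(X) = \sup\{t(p,X) : p \in X\}$ (following the standard convention that cardinal functions take infinite values). Regular spaces are understood to be $T_1$ (hence Hausdorff). *)

(* Defs.v *)
From HB Require Import structures.
From mathcomp Require Import all_boot all_order.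
From mathcomp Require Import boolp classical_sets functions cardinality.
From mathcomp Require Import topology borel_hierarchy.

Set Implicit Arguments.
Unset Strict Implicit.
Unset Printing Implicit Defensive.

Local Open Scope classical_set_scope.
Local Open Scope card_scope.

(* The library compares cardinals of sets ([#<=], [#=]) but has no type of
   cardinals; a cardinal is represented here by a set having that cardinal.
   The next lemmas show that least cardinals exist, so that tightness can be
   defined as an actual (representative of a) cardinal. *)

(* A maximal set of pairwise everywhere-distinct elements of the product of
   the [A i] projects onto some [A i], and injectively into all of them. *)
Lemma card_le_min (I : Type) (i0 : I) (T : I -> Type)
    (A : forall i, set (T i)) :
  exists i, forall j, A i #<= A j.
Proof.
pose P : set (set (forall i, T i)) := [set X |
  (forall f, X f -> forall i, A i (f i)) /\
  (forall f g, X f -> X g -> forall i, f i = g i -> f = g)].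
have [F FP Ftot|X [[XA Xinj] Xmax]] := @Zorn_bigcup _ P.
  split=> [f [X /FP[XA _] Xf]|f g [X FX Xf] [Y FY Yg]]; first exact: XA.
  have [XY|YX] := Ftot _ _ FX FY.
    by have [_] := FP _ FY; apply => //; exact: XY.
  by have [_] := FP _ FX; apply => //; exact: YX.
have [i iX] : exists i, A i `<=` (fun f => f i) @` X.
  apply: contrapT => /forallNP H.
  have {}H i : exists x, A i x /\ forall f, X f -> f i <> x.
    have /existsNP[x /not_implyP[Ax nx]] := H i.
    by exists x; split => // f Xf fx; apply: nx; exists f.
  pose h i := sval (cid (H i)).
  have hA i : A i (h i) by have [] := svalP (cid (H i)).
  have hX i f : X f -> f i <> h i by have [_] := svalP (cid (H i)); apply.
  apply: (Xmax (X `|` [set h])).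
    split; first by move=> f; left.
    by move=> /(_ h (or_intror erefl)) Xh; exact: (hX i0 h Xh).
  split=> [f [/XA //|-> //]|f g [Xf|->] [Xg|->] i //].
  - exact: Xinj.
  - by move=> /(hX _ _ Xf).
  - by move=> /esym/(hX _ _ Xg).
exists i => j; apply: (@card_le_trans _ _ _ X).
  apply: card_le_trans (card_image_le (fun f => f i) X).
  exact: subset_card_le.
have /card_eqPle[_ /card_le_trans] : (fun f => f j) @` X #= X.
  by apply: inj_card_eq => f g /set_mem Xf /set_mem Xg; exact: Xinj.
by apply; apply: subset_card_le => _ [f Xf <-]; exact: XA.
Qed.

Lemma card_le_total (T U : Type) (A : set T) (B : set U) :
  A #<= B \/ B #<= A.
Proof.
pose S b := match b return set (if b then T else U) with
            | true => A | false => B end.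
have [[] H] := @card_le_min bool true (fun b => if b then T else U) S.
  by left; exact: (H false).
by right; exact: (H true).
Qed.

Definition least_infinite (P : forall U : Type, set U -> Prop)
    (T : Type) (K : set T) : Prop :=
  [/\ infinite_set K, P T K &
      forall (U : Type) (L : set U), infinite_set L -> P U L -> K #<= L].

Lemma card_le_infinite (T U : Type) (A : set T) (B : set U) :
  A #<= B -> infinite_set A -> infinite_set B.
Proof.
by move=> AB /infiniteP nA; apply/infiniteP; exact: card_le_trans AB.
Qed.

Lemma least_infinite_exists (P : forall U : Type, set U -> Prop) (T : Type) :
  (forall (U V : Type) (L : set U) (M : set V),
     L #<= M -> P U L -> P V M) ->
  infinite_set [set: T] -> P T [set: T] ->
  exists K : set T, least_infinite P K.
Proof.
move=> Pmono Tinf PT.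
pose I := {K : set T | infinite_set K /\ P T K}.
have [[K [Kinf PK]] Kmin] :=
  @card_le_min I (exist _ setT (conj Tinf PT)) (fun=> T) (fun K => sval K).
exists K; split=> // U L Linf PL.
have [LT|TL] := card_le_total L [set: T]; last first.
  exact: card_le_trans (card_leT _) TL.
have /card_subP[M] := LT.
rewrite card_eq_le => /andP[ML LM] _.
have MI : infinite_set M /\ P T M.
  by split; [exact: card_le_infinite LM Linf | exact: Pmono LM PL].
exact: card_le_trans (Kmin (exist _ M MI)) ML.
Qed.

Lemma infinite_setT_sum_nat (T : Type) : infinite_set [set: T + nat].
Proof.
apply/infiniteP; have /card_eqPle[_ /card_le_trans] :
    (@inr T nat) @` [set: nat] #= [set: nat].
  by apply: inj_card_eq => m n _ _ [].
by apply; exact: card_leT.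
Qed.

Section tightness.
Variable X : topologicalType.

Definition tight_at (p : X) (U : Type) (K : set U) : Prop :=
  forall A : set X, closure A p ->
    exists B : set X, [/\ B `<=` A, B #<= K & closure B p].

Lemma tight_at_le (p : X) (U V : Type) (K : set U) (L : set V) :
  K #<= L -> tight_at p K -> tight_at p L.
Proof.
move=> KL tK A /tK[B [BA BK Bp]]; exists B; split=> //.
exact: card_le_trans KL.
Qed.

Lemma card_le_sum_nat (A : set X) : A #<= [set: X + nat].
Proof.
have /card_eqPle[_ /card_le_trans] : (@inl X nat) @` A #= A.
  by apply: inj_card_eq => x y _ _ [].
by apply; exact: card_leT.
Qed.

(* [X + nat] only serves as a carrier large enough to represent the cardinals
   [t(p, X)] and [t(X)], even when [X] is finite. *)
Lemma point_tightness_exists (p : X) :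
  exists K : set (X + nat), least_infinite (@tight_at p) K.
Proof.
apply: least_infinite_exists (@infinite_setT_sum_nat X) _.
  exact: tight_at_le.
by move=> A Ap; exists A; split=> //; exact: card_le_sum_nat.
Qed.

Definition point_tightness (p : X) : set (X + nat) :=
  sval (cid (point_tightness_exists p)).

Lemma point_tightnessP (p : X) :
  least_infinite (@tight_at p) (point_tightness p).
Proof. exact: svalP (cid (point_tightness_exists p)). Qed.

Definition bounds_tightness (U : Type) (K : set U) : Prop :=
  forall p : X, point_tightness p #<= K.

Lemma tightness_exists :
  exists K : set (X + nat), least_infinite bounds_tightness K.
Proof.
apply: least_infinite_exists (@infinite_setT_sum_nat X) _.
  by move=> U V L M LM bL p; exact: card_le_trans LM.
by move=> p; exact: card_leT.
Qed.

(* Least upper bound among the infinite cardinals, so that [t(X)] is infinite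
   also when [X] is empty. *)
Definition tightness : set (X + nat) := sval (cid tightness_exists).

Lemma tightnessP : least_infinite bounds_tightness tightness.
Proof. exact: svalP (cid tightness_exists). Qed.

End tightness.
Arguments tightness : clear implicits.

(* The set of subsets of [A], which has cardinal 2^|A|. *)
Definition card_pow2 (T : Type) (A : set T) : set (set T) :=
  [set B | B `<=` A].

Definition lindelof_space (X : topologicalType) : Prop :=
  forall F : set (set X),
    (forall U, F U -> open U) -> \bigcup_(U in F) U = setT ->
    exists G : set (set X),
      [/\ G `<=` F, countable G & \bigcup_(U in G) U = setT].

Definition Gdelta_mod (X : topologicalType) : Type := X.

Section Gdelta_mod_topology.
Variable X : topologicalType.

Lemma Gdelta_cover : \bigcup_(S in @Gdelta X) S = setT.
Proof.
by rewrite -subTset => x _; exists setT => //; exact: open_Gdelta openT.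
Qed.

Lemma Gdelta_join (S S' : set X) (x : X) : Gdelta S -> Gdelta S' ->
  S x -> S' x -> exists R, [/\ Gdelta R, R x & R `<=` S `&` S'].
Proof.
move=> [F Fo ->] [G Go ->] Fx Gx.
exists (\bigcap_i (F i `&` G i)); split.
- by exists (fun i => F i `&` G i) => // i; exact: openI.
- by move=> i _; split; [exact: Fx | exact: Gx].
- by move=> y FGy; split=> i _; have [] := FGy i I.
Qed.

HB.instance Definition _ := Choice.on (Gdelta_mod X).
HB.instance Definition _ := isBaseTopological.Build (Gdelta_mod X)
  Gdelta_cover Gdelta_join.

Lemma open_Gdelta_modE (A : set (Gdelta_mod X)) :
  open A <-> exists2 D : set (set X), D `<=` @Gdelta X & \bigcup_(S in D) S = A.
Proof. by []. Qed.

End Gdelta_mod_topology.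

(* Main.v *)
Require Import Defs.
From mathcomp Require Import all_boot all_order.
From mathcomp Require Import boolp classical_sets functions cardinality.
From mathcomp Require Import topology borel_hierarchy.

(** Let k = t(X), let p lie in the closure of A in the G_delta-modification,
    and call a G_delta set containing p a neighbourhood of p. The set B <= A of
    size at most 2^k that still accumulates at p is obtained by closing off
    under one operation, which plays the part of an elementary submodel of
    size 2^k closed under k-sequences.

    To a k-indexed family c of points and a set D of indices, associate an open
    set W(c, D) with p outside its closure, chosen so as to contain the closure
    of c(D) whenever such an open set exists. Only 2^k sets D are needed to
    handle all the points of the closure of the range of c except p itself
    ([separating_opens]): by regularity a point z <> p has open sets V and O
    with z in V, cl V inside O and p outside cl O; for D = c^-1(V), the set O
    shows that W(c, D) contains cl c(D), and z is in cl c(D).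

    The operation takes countably many pairs (c, D) and returns a point of A
    outside all the W(c, D): it exists, because the complements of the closures
    of the W(c, D) intersect in a neighbourhood of p. Let B be the smallest set
    closed under it that contains a given point of A. It has at most 2^k points ([smallest_closed_set]), since
    its points are values of well-founded trees with k-fold branching and nodes
    labelled by subsets of k; such a tree amounts to a set of finite sequences
    over k, and there are k such sequences ([infinite_seq_coding], which rests
    on k * k = k, [infinite_pairing]).

    Finally let G be the intersection of open sets U_m, and p a point of G. By
    tightness each point of cl B \ U_m lies in the closure of at most k points
    of B, hence in some W(c, D) with c valued in B; as cl B \ U_m is closed in
    a Lindelof space, countably many pairs (c, D) suffice for it, and countably
    many for all m together. The operation applied to these pairs yields a point
    of B outside each cl B \ U_m, that is, a point of B in G. *)

Set Implicit Arguments.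
Unset Strict Implicit.
Unset Printing Implicit Defensive.

Local Open Scope classical_set_scope.
Local Open Scope card_scope.

(** * Cardinal arithmetic *)

Lemma card_le_exinj (T U : Type) (u : U) (A : set T) (B : set U) :
  A #<= B -> exists2 f : T -> U, set_fun A B f & set_inj A f.
Proof. by move=> /card_leP[f]; apply/injfunPex; squash (valLR u f). Qed.

Lemma exinj_card_le (T U : Type) (f : T -> U) (A : set T) (B : set U) :
  set_fun A B f -> set_inj A f -> A #<= B.
Proof.
move=> fAB finj; have /injfunPex[g] : exists2 f, set_fun A B f & set_inj A f.
  by exists f.
exact: inj_card_le.
Qed.

Lemma infinite_inj_nat (K : Type) : infinite_set [set: K] ->
  exists i : nat -> K, injective i.
Proof.
move=> Kinf; have [k0 _] := infinite_setN0 Kinf.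
have /infiniteP/(card_le_exinj k0)[i _ iinj] := Kinf.
by exists i => m n; apply: iinj; rewrite inE.
Qed.

Section pairing.
Variable K : Type.

Definition pairing_on (S : set K) (F : K -> K -> K) : Prop :=
  (forall x y, S x -> S y -> S (F x y)) /\
  (forall x y x' y', S x -> S y -> S x' -> S y' ->
     F x y = F x' y' -> x = x' /\ y = y').

(** The second components are total functions so that no partial functions are
    needed; their values outside the square of the first component are junk,
    which is why this relation is only a preorder. *)
Definition pairing_le (P Q : set K * (K -> K -> K)) : Prop :=
  P.1 `<=` Q.1 /\ forall x y, P.1 x -> P.1 y -> Q.2 x y = P.2 x y.

Lemma pairing_le_trans P Q R :
  pairing_le P Q -> pairing_le Q R -> pairing_le P R.
Proof.
move=> [PQ PQE] [QR QRE]; split=> [x /PQ/QR //|x y Px Py].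
by rewrite QRE ?PQE //; exact: PQ.
Qed.

(** Any two elements of a chain, hence any finitely many points of the union of
    the first components, fall into a single member of the chain; there the
    union inherits the properties of a pairing. *)
Lemma pairing_chain (C : set (set K * (K -> K -> K))) :
  (forall P, C P -> pairing_on P.1 P.2) -> total_on C pairing_le -> C !=set0 ->
  exists Q, pairing_on Q.1 Q.2 /\ forall P, C P -> pairing_le P Q.
Proof.
move=> Cgood Ctot [P0 CP0].
have common P Q : C P -> C Q ->
    exists R, [/\ C R, pairing_le P R & pairing_le Q R].
  move=> CP CQ; have [PQ|QP] := Ctot _ _ CP CQ.
    by exists Q; split=> //; split.
  by exists P; split=> //; split.
pose S := \bigcup_(P in C) P.1.
have /choice[F FE] : forall xy : K * K, exists z, forall P, C P -> P.1 xy.1 ->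
    P.1 xy.2 -> z = P.2 xy.1 xy.2.
  move=> [x y] /=; have [[P [CP Px Py]]|nP] :=
    pselect (exists P, [/\ C P, P.1 x & P.1 y]); last first.
    by exists x => P CP Px Py; case: nP; exists P.
  exists (P.2 x y) => Q CQ Qx Qy.
  have [R [_ [_ PR] [_ QR]]] := common _ _ CP CQ.
  by rewrite -PR // -QR.
exists (S, fun x y => F (x, y)); split=> /= [|P CP]; last first.
  by split=> [x Px|x y Px Py]; [exists P|exact: FE].
split=> [x y [P CP Px] [Q CQ Qy]|
         x y x' y' [P CP Px] [Q CQ Qy] [P' CP' Px'] [Q' CQ' Qy']].
  have [R [CR [/(_ _ Px) Rx _] [/(_ _ Qy) Ry _]]] := common _ _ CP CQ.
  by exists R => //; rewrite (FE (x, y) R) //=; exact: (Cgood R CR).1.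
have [R [CR [PR _] [QR _]]] := common _ _ CP CQ.
have [R' [CR' [PR' _] [QR' _]]] := common _ _ CP' CQ'.
have [V [CV [RV _] [RV' _]]] := common _ _ CR CR'.
have [Vx Vy Vx' Vy'] : [/\ V.1 x, V.1 y, V.1 x' & V.1 y'].
  by split; [exact/RV/PR|exact/RV/QR|exact/RV'/PR'|exact/RV'/QR'].
by rewrite (FE (x, y) V) //= (FE (x', y') V) //; exact: (Cgood V CV).2.
Qed.

(** If T exceeds S by at most the size of S, then T embeds into two disjoint
    copies of S, namely F(S x {a}) and F(S x {b}); applying F to pairs of such
    codes pairs the elements of T by elements of S. *)
Lemma pairing_double (S T : set K) (F : K -> K -> K) (a b : K) (d : K -> K) :
  pairing_on S F -> S a -> S b -> a <> b ->
  set_fun (T `\` S) S d -> set_inj (T `\` S) d ->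
  exists h : K -> K -> K, (forall x y, T x -> T y -> S (h x y)) /\
    (forall x y x' y', T x -> T y -> T x' -> T y' ->
       h x y = h x' y' -> x = x' /\ y = y').
Proof.
move=> [FS Finj] Sa Sb ab dS dinj.
pose u x := if pselect (S x) then F x a else F (d x) b.
have uS x : T x -> S (u x).
  by rewrite /u; case: pselect => Sx Tx; apply: FS => //; exact: dS.
have uinj x y : T x -> T y -> u x = u y -> x = y.
  rewrite /u; case: pselect => Sx; case: pselect => Sy Tx Ty.
  - by case/Finj.
  - by case/Finj=> //; exact: dS.
  - by case/Finj => //; [exact: dS|move=> _ /esym].
  - case/Finj => //; [exact: dS|exact: dS|move=> + _].
    by apply: dinj; rewrite inE.
exists (fun x y => F (u x) (u y)); split=> [x y Tx Ty|x y x' y' Tx Ty Tx' Ty'].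
  by apply: FS; exact: uS.
by case/Finj; try exact: uS; move=> /uinj-> // /uinj->.
Qed.

(** This is the equality k * k = k for infinite cardinals. A maximal pairing
    (S, F) above a countable one has a first component S at least as large as
    its complement: otherwise the complement contains a copy g(S) of S, and F
    extends to the square of the union T of S and g(S), the new pairs being sent
    into g(S). Then [pairing_double] gives a pairing of K. *)
Lemma infinite_pairing : infinite_set [set: K] ->
  exists F : K -> K -> K, forall x y x' y', F x y = F x' y' -> x = x' /\ y = y'.
Proof.
move=> Kinf; have [k0 _] := infinite_setN0 Kinf.
have [i iinj] := infinite_inj_nat Kinf.
(* A left inverse of i transports a pairing of nat to the range of i. *)
have [j jK] : exists j, cancel i j.
  have /choice[j jP] : forall x, exists n, forall m, i m = x -> m = n.
    move=> x; have [[n nx]|nP] := pselect (exists n, i n = x).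
      by exists n => m; rewrite -nx => /iinj.
    by exists 0 => m mx; case: nP; exists m.
  by exists j => n; apply/esym; exact: jP.
pose P0 := (range i, fun x y => i (choice.pickle (j x, j y))).
have P0good : pairing_on P0.1 P0.2.
  split=> /= [x y _ _|x y x' y' [m _ <-] [n _ <-] [m' _ <-] [n' _ <-]].
    by exists (choice.pickle (j x, j y)).
  by rewrite !jK => /iinj/(pcan_inj choice.pickleK)[-> ->].
pose E := {P | pairing_on P.1 P.2 /\ pairing_le P0 P}.
have P0P0 : pairing_le P0 P0 by split.
pose e0 : E := exist _ P0 (conj P0good P0P0).
pose R (P Q : E) := `[< pairing_le (sval P) (sval Q) >].
have [||C Ctot|[[S F] [Sgood SP0]] Smax] := @ZL_preorder E e0 R.
- by move=> P; apply/asboolP; split.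
- move=> Q P W /asboolP PQ /asboolP QW; apply/asboolP.
  exact: pairing_le_trans QW.
- have [[P CP]|C0] := pselect (C !=set0); last first.
    by exists e0 => P CP; case: C0; exists P.
  have [|||Q [Qgood CQ]] := @pairing_chain ((@sval _ _) @` C).
  + by move=> _ [[W [Wgood /= _]] _ <-].
  + move=> _ _ [W CW <-] [V CV <-].
    by have [/asboolP|/asboolP] := Ctot _ _ CW CV; [left|right].
  + by exists (sval P); exists P.
  + have P0Q : pairing_le P0 Q.
      apply: (@pairing_le_trans _ (sval P)); first by case: (P) => W [].
      by apply: CQ; exists P.
    exists (exist _ Q (conj Qgood P0Q)) => W CW.
    by apply/asboolP; apply: CQ; exists W.
have S0 : S (i 0) by apply: SP0.1; exists 0.
have S1 : S (i 1) by apply: SP0.1; exists 1.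
have S01 : i 0 <> i 1 by move/iinj.
have [KS|SK] := card_le_total (~` S) S.
  have [d dS dinj] := card_le_exinj k0 KS.
  have [||h [_ hinj]] := @pairing_double S setT F _ _ d Sgood S0 S1 S01.
  + by rewrite setTD.
  + by rewrite setTD.
  by exists h => x y x' y'; exact: hinj.
have [g gS ginj] := card_le_exinj k0 SK.
have {}ginj x y : S x -> S y -> g x = g y -> x = y.
  by move=> Sx Sy; apply: ginj; rewrite inE.
have /choice[d dE] : forall y, exists x, forall z, S z -> g z = y -> x = z.
  move=> y; have [[x Sx xy]|nP] := pselect (exists2 x, S x & g x = y).
    by exists x => z Sz; rewrite -xy => /ginj ->.
  by exists y => z Sz zy; case: nP; exists z.
pose T := S `|` g @` S.
have TS x : (T `\` S) x -> exists2 z, S z & x = g z.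
  by move=> [[//|[z Sz <-]] _]; exists z.
have [||h [hS hinj]] := @pairing_double S T F _ _ d Sgood S0 S1 S01.
- by move=> x /TS[z Sz ->]; rewrite (dE _ z).
- move=> x y /set_mem/TS[z Sz ->] /set_mem/TS[w Sw ->].
  by rewrite (dE _ z) // (dE _ w) // => ->.
pose G x y := if pselect (S x /\ S y) then F x y else g (h x y).
have Tgood : pairing_on T G.
  split=> [x y Tx Ty|x y x' y' Tx Ty Tx' Ty']; rewrite /G.
    case: pselect => [[Sx Sy]|nS] /=; first by left; exact: Sgood.1.
    by right; exists (h x y) => //; exact: hS.
  case: pselect => [[Sx Sy]|nS]; case: pselect => [[Sx' Sy']|nS'] /=.
  - exact: Sgood.2.
  - by move=> FG; have [] := gS _ (hS _ _ Tx' Ty'); rewrite -FG; exact: Sgood.1.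
  - by move=> GF; have [] := gS _ (hS _ _ Tx Ty); rewrite GF; exact: Sgood.1.
  - by move/ginj => /(_ (hS _ _ Tx Ty) (hS _ _ Tx' Ty')); exact: hinj.
have ST : pairing_le (S, F) (T, G).
  by split=> [x Sx|x y Sx Sy] /=; [left|rewrite /G; case: pselect => // -[]].
pose t : E := exist _ (T, G) (conj Tgood (pairing_le_trans SP0 ST)).
have /asboolP[/= TS' _] := Smax t (asboolT ST).
have := gS _ S0; case; apply: TS'; right; by exists (i 0).
Qed.

(** The code records the length of the sequence, since the arbitrary element k0
    at which the decoding should stop may itself be the code of a pair. *)
Lemma infinite_seq_coding : infinite_set [set: K] ->
  exists c : seq (option K) -> K, injective c.
Proof.
move=> Kinf; have [k0 _] := infinite_setN0 Kinf.
have [i iinj] := infinite_inj_nat Kinf.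
have [F Finj] := infinite_pairing Kinf.
pose o x := if x is Some k then F (i 1) k else F (i 0) (i 0).
have oinj : injective o.
  by move=> [k|] [l|] //= /Finj[]; [move=> _ ->|move=> /iinj|move=> /iinj].
exists (fun s => F (i (size s)) (foldr (fun x => F (o x)) k0 s)) => s t.
move=> /Finj[/iinj]; elim: s t => [|x s IH] [|y t] //= [st] /Finj[/oinj -> E].
by rewrite (IH t).
Qed.

End pairing.

Lemma card_le_powerset (T U : Type) (A : set T) (B : set U) :
  A #<= B -> card_pow2 A #<= card_pow2 B.
Proof.
move=> AB; have [[b _]|B0] := pselect (B !=set0).
  have [f fAB finj] := card_le_exinj b AB.
  apply: (@exinj_card_le _ _ (fun S => f @` S)).
    by move=> S SA _ [x Sx <-]; exact/fAB/SA.
  have sub S S' : S `<=` A -> S' `<=` A -> f @` S = f @` S' -> S `<=` S'.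
    move=> SA S'A SS' x Sx; have [y S'y yx] : (f @` S') (f x).
      by rewrite -SS'; exists x.
    suff <- : y = x by [].
    by apply: finj => //; rewrite inE; [exact: S'A|exact: SA].
  move=> S S' /set_mem SA /set_mem S'A SS'.
  by apply/seteqP; split; apply: sub.
have A0 : A = set0.
  by apply/(card_le0P U); rewrite (_ : set0 = B) //; apply/esym/nonemptyPn.
rewrite A0; apply: (@exinj_card_le _ _ (fun=> set0)) => [S _ //|S S'].
by move=> /set_mem + /set_mem + _; rewrite /card_pow2/= !subset0 => -> ->.
Qed.

Lemma card_pow2T (T : Type) : card_pow2 [set: T] = [set: set T].
Proof. by apply/seteqP; split. Qed.

Lemma infinite_card_pow2 (T : Type) (A : set T) :
  infinite_set A -> infinite_set (card_pow2 A).
Proof.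
apply: card_le_infinite.
apply: (@exinj_card_le _ _ (fun x => [set x])) => [x Ax _ -> //|x y _ _ xy].
by have : [set x] x by []; rewrite xy.
Qed.

(** * Closing off under an operation *)

Section smallest_closed_set.
Variables (I X : Type) (x0 : X) (f : set I -> (I -> X) -> X).

Inductive op_tree := op_leaf | op_node (l : set I) (t : I -> op_tree).

Fixpoint op_eval (t : op_tree) : X :=
  if t is op_node l ch then f l (fun i => op_eval (ch i)) else x0.

(** The nonempty codes are those of nodes. A sequence in the code is a path
    towards a node, ended by nothing or, after the separator [None], by an
    element of the label of that node. *)
Fixpoint op_code (t : op_tree) : set (seq (option I)) :=
  if t is op_node l ch then
    fun s => match s with
    | [::] => True
    | Some i :: s => op_code (ch i) s
    | [:: None; Some i] => l i
    | _ => False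
    end
  else set0.

Lemma op_code_inj : injective op_code.
Proof.
elim=> [|l ch IH] [|l' ch'] //= cc.
- by have : (set0 : set (seq (option I))) [::] by rewrite cc.
- by have : (set0 : set (seq (option I))) [::] by rewrite -cc.
congr op_node; apply/funext => i.
  exact: (congr1 (@^~ [:: None; Some i]) cc).
by apply: IH; apply/funext => s; exact: (congr1 (@^~ (Some i :: s)) cc).
Qed.

(** The points generated by f are the values of well-founded trees, and a tree
    is determined by a set of finite sequences over I, of which there are only
    |I|. *)
Lemma smallest_closed_set : infinite_set [set: I] ->
  exists B : set X, [/\ B x0,
    forall l g, (forall i, B (g i)) -> B (f l g),
    forall C : set X, C x0 -> (forall l g, C (f l g)) -> B `<=` C &
    B #<= [set: set I]].
Proof.
move=> Iinf; exists (range op_eval); split.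
- by exists op_leaf.
- move=> l g /(_ _)/cid2-/all_sig2[t _ tg].
  exists (op_node l t) => //=.
  by congr f; apply/funext => i.
- by move=> C C0 Cf _ [[|l t] _ <-] /=.
apply: card_le_trans (card_image_le _ _) _.
apply: (@card_le_trans _ _ _ [set: set (seq (option I))]).
  by apply: (@exinj_card_le _ _ op_code) => // s t _ _; exact: op_code_inj.
have [c cinj] := infinite_seq_coding Iinf.
rewrite -!card_pow2T; apply: card_le_powerset.
by apply: (@exinj_card_le _ _ c) => // s t _ _; exact: cinj.
Qed.

End smallest_closed_set.

(** * Topology *)

Lemma closure_Gdelta_modP (X : topologicalType) (A : set X) (p : X) :
  closure (A : set (Gdelta_mod X)) p <->
  forall G, Gdelta G -> G p -> A `&` G !=set0.
Proof.
split=> [Ap G Gd Gp|AG B]; last first.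
  rewrite nbhsE => -[O [/open_Gdelta_modE[D Dd <-] [S DS Sp]] OB].
  have [x [Ax Sx]] := AG _ (Dd _ DS) Sp; exists x; split=> //.
  by apply: OB; exists S.
apply: Ap; rewrite nbhsE; exists G => //; split=> //.
by apply/open_Gdelta_modE; exists [set G]; [move=> _ ->|rewrite bigcup_set1].
Qed.

Lemma regular_accessible_open_closure (X : topologicalType) (p z : X) :
  regular_space X -> accessible_space X -> z <> p ->
  exists O V : set X,
    [/\ open O, open V, V z, closure V `<=` O & ~ closure O p].
Proof.
move=> Xreg XT1 /eqP/XT1[U [Uo /set_mem Uz /set_mem Up]].
have shrink W : open W -> W z -> exists V, [/\ open V, V z & closure V `<=` W].
  move=> Wo Wz; have [V Vz VW] := Xreg z W (open_nbhs_nbhs (conj Wo Wz)).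
  exists (interior V); split=> //; first exact: open_interior.
  by apply: subset_trans VW; apply: closureS; exact: interior_subset.
have [O [Oo Oz OU]] := shrink _ Uo Uz.
have [V [Vo Vz VO]] := shrink _ Oo Oz.
by exists O, V; split=> // /OU.
Qed.

(** The closure of the range of c may have more than 2^|K| points, but without
    p it is covered by the 2^|K| sets W(c, D): each of its points z lies in
    W(c, D) for D the set of indices sent by c into a small neighbourhood
    of z. *)
Lemma separating_opens (X : topologicalType) (p : X) (K : Type) :
  regular_space X -> accessible_space X ->
  exists W : (K -> X) -> set K -> set X,
    (forall c D, open (W c D)) /\ (forall c D, ~ closure (W c D) p) /\
    forall c z, closure (range c) z -> z <> p -> exists D, W c D z.
Proof.
move=> Xreg XT1.
pose good (cD : (K -> X) * set K) (O : set X) :=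
  [/\ open O, ~ closure O p & closure (cD.1 @` cD.2) `<=` O].
have /choice[W WP] : forall cD, exists O, [/\ open O, ~ closure O p &
    (exists O', good cD O') -> closure (cD.1 @` cD.2) `<=` O].
  move=> cD; have [[O [Oo Op OD]]|nO] := pselect (exists O, good cD O).
    by exists O; split.
  exists set0; split=> //; first exact: open0.
  by rewrite closure0.
exists (fun c D => W (c, D)).
split=> [c D|]; first by have [] := WP (c, D).
split=> [c D|c z cz zp]; first by have [] := WP (c, D).
have [O [V [Oo Vo Vz VO Op]]] := regular_accessible_open_closure Xreg XT1 zp.
exists (c @^-1` V); have [_ _] := WP (c, c @^-1` V); apply=> /=.
  exists O; split=> //; apply: subset_trans VO; apply: closureS.
  by move=> _ [k Vk <-].
move=> N Nz.
have VNz : nbhs z (V `&` N) by apply: filterI Nz; exact: open_nbhs_nbhs.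
have [_ [[k _ <-] [Vk Nk]]] := cz (V `&` N) VNz.
by exists (c k); split=> //; exists k.
Qed.

(** The default j0 fills the places of the enumeration that name no set U j of
    the countable subcover, all of them if F is empty. *)
Lemma lindelof_closed_subcover (X : topologicalType) (J : Type) (j0 : J)
    (F : set X) (U : J -> set X) :
  lindelof_space X -> closed F -> (forall j, open (U j)) ->
  F `<=` \bigcup_j U j ->
  exists j : nat -> J, F `<=` \bigcup_n U (j n).
Proof.
move=> Xlin Fc Uo FU.
have [||G [Gsub Gc GT]] := Xlin ([set ~` F] `|` range U).
- by move=> _ [->|[j _ <-]] //; exact: closed_openC.
- rewrite -subTset => x _; have [Fx|nFx] := pselect (F x).
    by have [j _ Ujx] := FU _ Fx; exists (U j) => //; right; exists j.
  by exists (~` F) => //; left.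
have [e einj] := countable_injP _ Gc.
have /choice[j jP] : forall n, exists j, forall V, G V -> e V = n ->
    V = ~` F \/ V = U j.
  move=> n; have [[V [GV Vn]]|nV] := pselect (exists V, G V /\ e V = n).
    have [VF|[j _ jV]] := Gsub _ GV; [exists j0|exists j] => V' GV' V'n.
      by left; rewrite -VF; apply: einj; rewrite ?inE // V'n.
    by right; rewrite jV; apply: einj; rewrite ?inE // V'n.
  by exists j0 => V GV Vn; case: nV; exists V.
exists j => x Fx; have : [set: X] x by [].
rewrite -GT => -[V GV Vx]; exists (e V) => //.
by have [VF|<- //] := jP (e V) V GV erefl; move: Vx; rewrite VF.
Qed.

(** An index (m, n, k) stands for the k-th point of the n-th family used to
    cover the m-th closed set, so that a label and an argument of the operation
    encode a double sequence of pairs (c, D). *)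
Lemma tight_at_Gdelta_mod (X : topologicalType) (K : Type) :
  regular_space X -> accessible_space X -> lindelof_space X ->
  infinite_set [set: K] -> (forall q : X, tight_at q [set: K]) ->
  forall p : Gdelta_mod X, tight_at p [set: set (nat * nat * K)].
Proof.
move=> Xreg XT1 Xlin Kinf Xtight p A /closure_Gdelta_modP Ap.
have [k0 _] := infinite_setN0 Kinf.
have [W [Wo [Wp Wz]]] := @separating_opens X p K Xreg XT1.
pose piece (l : set (nat * nat * K)) (g : nat * nat * K -> X) m n : set X :=
  W (fun k => g (m, n, k)) (fun k => l (m, n, k)).
have /choice[f fP] : forall lg : set (nat * nat * K) * (nat * nat * K -> X),
    exists a, A a /\ forall m n, ~ piece lg.1 lg.2 m n a.
  move=> [l g]; pose N i := ~` closure
    (let mn := odflt (0, 0) (choice.unpickle i) in piece l g mn.1 mn.2).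
  have [||a [Aa Na]] := Ap (\bigcap_i N i).
  - by exists N => // i; apply: closed_openC; exact: closed_closure.
  - by move=> i _; exact: Wp.
  exists a; split=> // m n /=.
  have := Na (choice.pickle (m, n)) I; rewrite /N /= choice.pickleK /=.
  by apply: contra_not; exact: subset_closure.
have [|a0 [Aa0 _]] := Ap setT _ I; first exact/open_Gdelta/openT.
have [|B [Ba0 Bf Bmin Bcard]] :=
    @smallest_closed_set (nat * nat * K) X a0 (fun l g => f (l, g)).
  apply: card_le_infinite Kinf.
  by apply: (@exinj_card_le _ _ (fun k => (0, 0, k))) => // k k' _ _ [].
have BA : B `<=` A by apply: Bmin => // l g; have [] := fP (l, g).
exists B; split=> //; apply/closure_Gdelta_modP => G [U Uo ->] Up.
(* Unlike the complement of [U m], its trace on [closure B] is reached from B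
   by families of size |K|. *)
pose F m := closure B `\` U m.
pose V (cD : (K -> {x | B x}) * set K) := W (fun k => sval (cD.1 k)) cD.2.
pose b0 : {x | B x} := exist _ a0 Ba0.
have cover m : F m `<=` \bigcup_cD V cD.
  move=> z [Bz nUz].
  have zp : z <> p by move=> zp; apply: nUz; rewrite zp; exact: Up.
  (* Being of size at most |K|, the set C lies in the range of a family c of
     points of B, with value b0 at the indices that stand for no point of C. *)
  have [C [CB CK Cz]] := Xtight z B Bz.
  have [h _ hinj] := card_le_exinj k0 CK.
  have /choice[c cP] : forall k, exists b : {x | B x},
      forall y, C y -> h y = k -> sval b = y.
    move=> k; have [[y [Cy yk]]|nC] := pselect (exists y, C y /\ h y = k).
      exists (exist _ y (CB y Cy)) => x Cx xk.
      by apply: hinj; rewrite ?inE //= xk.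
    by exists b0 => y Cy yk; case: nC; exists y.
  have cz : closure (range (fun k => sval (c k))) z.
    by apply: closureS Cz => y Cy; exists (h y) => //; exact: cP.
  by have [D Dz] := Wz _ _ cz zp; exists (c, D).
have /choice[j jP] : forall m, exists j : nat -> (K -> {x | B x}) * set K,
    F m `<=` \bigcup_n V (j n).
  move=> m.
  apply: (lindelof_closed_subcover (fun=> b0, set0) Xlin _ _ (@cover m)).
    by apply: closedI; [exact: closed_closure|exact/open_closedC/Uo].
  by move=> cD; exact: Wo.
pose l (i : nat * nat * K) := (j i.1.1 i.1.2).2 i.2.
pose g (i : nat * nat * K) := sval ((j i.1.1 i.1.2).1 i.2).
have Ba : B (f (l, g)) by apply: Bf => i; exact: svalP.
exists (f (l, g)); split=> // m _; apply: contrapT => nUa.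
have [|n _] := jP m (f (l, g)).
  by split=> //; exact: subset_closure.
by have [_ /(_ m n)] := fP (l, g).
Qed.

Theorem theorem2p1 (X : topologicalType) :
  regular_space X -> accessible_space X -> lindelof_space X ->
  tightness (Gdelta_mod X) #<= card_pow2 (tightness X).
Proof.
move=> Xreg XT1 Xlin.
have [Kinf Kbound _] := tightnessP X.
set K := tightness X in Kinf Kbound *.
have /card_eqPle[K'K KK'] : [set: K] #= K by exact: card_setT.
have K'inf : infinite_set [set: K] by exact: card_le_infinite Kinf.
have XK (q : X) : tight_at q [set: K].
  have [_ tq _] := point_tightnessP q.
  by apply: tight_at_le tq; apply: card_le_trans KK'; exact: Kbound.
have IK : [set: set (nat * nat * K)] #<= card_pow2 K.
  have [i iinj] := infinite_inj_nat K'inf.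
  have [F Finj] := infinite_pairing K'inf.
  rewrite -card_pow2T; apply: card_le_powerset; apply: card_le_trans K'K.
  apply: (@exinj_card_le _ _ (fun x => F (i x.1.1) (F (i x.1.2) x.2))) => //.
  by move=> [[m n] k] [[m' n'] k'] _ _ /= /Finj[/iinj-> /Finj[/iinj-> ->]].
(* Both tightness cardinals being least, it suffices that 2^|K| is infinite and
   bounds the tightness at each point. *)
have [_ _ +] := tightnessP (Gdelta_mod X); apply.
  exact: infinite_card_pow2.
move=> p; have [_ _ +] := point_tightnessP p; apply.
  exact: infinite_card_pow2.
apply: tight_at_le IK _.
exact: tight_at_Gdelta_mod Xreg XT1 Xlin K'inf XK p.
Qed.
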